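(* Let $\overline{M}$ be the persistence module indexed by $\mathbb{R}$ associated to a persistence module $M$ indexed by $[m]$ and an injective order-preserving map $\iota:[m+1]\to\mathbb{R}$. Let $k\ge1$, let $\lambda_k:\mathbb{R}\to\mathbb{R}$ be the $k$-th persistence landscape of $\overline{M}$ and let $\operatorname{PD}_k=\operatorname{PD}_k(\overline M)$ be the $k$-th graded persistence diagram of $\overline{M}$. Then: (1) $\lambda_k$ is a continuous piecewise-linear function. (2) Let $t\in\mathbb{R}$ be such that $h:=\lambda_k(t)>0$. Then $\lambda_k$ has a local maximum at $t$ if and only if $\operatorname{PD}_k[t-h,t+h)=1$, and $\lambda_k$ has a local minimum at $t$ if and only if $\operatorname{PD}_k[t-h,t+h)=-1$. (3) If $\lambda_k'(t)$ exists then $\lambda_k'(t)\in\{-1,0,1\}$, and $\lambda_k'(t)=0$ implies that $\lambda_k(t)=0$.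
   Context: Let $F$ be a field, $[m]=\{0<1<\dots<m\}$. A persistence module indexed by a sub-poset $P$ of $(\mathbb{R},\le)$ is a functor from $P$ to finite-dimensional $F$-vector spaces. Given $M$ indexed by $[m]$, extend it to $\hat M$ indexed by $[m+1]$ by $\hat M(m+1)=0$. Given an injective order-preserving $\iota:[m+1]\to\mathbb{R}$, $\overline M$ is the persistence module indexed by $\mathbb{R}$ with $\overline M(a)=\hat M(i)$, where $i$ is the largest element of $[m+1]$ with $\iota(i)\le a$, and $\overline M(a)=0$ if $a<\iota(0)$, with structure maps induced by those of $\hat M$. For a poset $P$, $P^2_<$ denotes the poset of half-open intervals $[a,b)$, $a<b$ in $P$, ordered by inclusion. $\operatorname{Rank}(M)[a,b)=\operatorname{rank}M(a\le b-1)$ for $[a,b)\in[m+1]^2_<$, and $\operatorname{Rank}(\overline M)[a,b)=\min_{a\le c<b}\operatorname{rank}\overline M(a\le c)$ for $[a,b)\in\mathbb{R}^2_<$. For $k\ge1$, $\operatorname{Rank}_k=u_k\circ\operatorname{Rank}$, where $u_k(n)=1$ if $n\ge k$ and $0$ otherwise. The $k$-th graded persistence diagram of $M$ is $\operatorname{PD}_k(M):[m+1]^2_<\to\mathbb{Z}$, $\operatorname{PD}_k(M)=\mu*\operatorname{Rank}_k(M)$, i.e. $\operatorname{PD}_k(M)(I)=\sum_{I\subseteq I'}\mu[I,I']\operatorname{Rank}_k(M)(I')$, where $\mu$ is the Möbius function of $[m+1]^2_<$ ($\mu[x,x]=1$, $\mu[x,y]=-\sum_{x\le y'<y}\mu[x,y']$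 for $x<y$). The $k$-th graded persistence diagram of $\overline M$ is $\operatorname{PD}_k(\overline M):\mathbb{R}^2_<\to\mathbb{Z}$ with $\operatorname{PD}_k(\overline M)[\iota(x),\iota(y))=\operatorname{PD}_k(M)[x,y)$ and value $0$ on all other intervals. The $k$-th persistence landscape is $\lambda_k(t)=\sup\{h>0 : \operatorname{Rank}_k(\overline M)[t-h,t+h)=1\}$, with $\lambda_k(t)=0$ if this set is empty. *)

(* Defs.v *)
From HB Require Import structures.
From mathcomp Require Import all_boot all_order all_algebra.
From mathcomp Require Import all_classical all_reals all_analysis.

Set Implicit Arguments.
Unset Strict Implicit.
Unset Printing Implicit Defensive.

Import Order.TTheory GRing.Theory Num.Theory.
Import numFieldNormedType.Exports.

Local Open Scope ring_scope.

Record pmod (F : fieldType) (d : Order.disp_t) (P : porderType d) := PMod {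
  pobj :> P -> vectType F;
  pmap : forall a b : P, (a <= b)%O -> 'Hom(pobj a, pobj b);
  pmap_id : forall (a : P) (aa : (a <= a)%O), pmap aa = \1%VF;
  pmap_comp : forall (a b c : P) (ab : (a <= b)%O) (bc : (b <= c)%O)
    (ac : (a <= c)%O), pmap ac = (pmap bc \o pmap ab)%VF }.

Definition lrank (F : fieldType) (U V : vectType F) (f : 'Hom(U, V)) : nat :=
  \dim (limg f).

(* Pullback of a module along a partially defined index map, with value the
   zero space where the index map is undefined. Both [M-hat] and [M-bar] are
   instances. *)
Section ZeroExtension.
Context (F : fieldType) (d d' : Order.disp_t).
Context (P : porderType d) (Q : porderType d') (M : pmod F Q).

Definition ole (o o' : option Q) : bool :=
  match o, o' with Some q, Some q' => (q <= q')%O | _, _ => true end.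

Definition zobj (o : option Q) : vectType F :=
  if o is Some q then M q else 'rV[F]_0.

Definition zmap (o o' : option Q) : ole o o' -> 'Hom(zobj o, zobj o') :=
  match o, o' return ole o o' -> 'Hom(zobj o, zobj o') with
  | Some q, Some q' => fun qq' => pmap M qq'
  | _, _ => fun=> 0
  end.

Lemma zmap_id (o : option Q) (oo : ole o o) : zmap oo = \1%VF.
Proof.
case: o oo => [q|] oo /=; first exact: pmap_id.
by apply/lfunP => x; rewrite [LHS]thinmx0 [RHS]thinmx0.
Qed.

Lemma zmap_comp (o1 o2 o3 : option Q) (h12 : ole o1 o2) (h23 : ole o2 o3)
    (h13 : ole o1 o3) : (o1 -> o3 -> o2) ->
  zmap h13 = (zmap h23 \o zmap h12)%VF.
Proof.
case: o1 h12 h13 => [q1|]; case: o2 h23 => [q2|]; case: o3 => [q3|] //=;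
  move=> h23 h12 h13 conv; rewrite ?comp_lfun0l ?comp_lfun0r //.
- exact: pmap_comp.
- by have := conv isT isT.
Qed.

Context (idx : P -> option Q).
Context (idx_mono : forall a b : P, (a <= b)%O -> ole (idx a) (idx b)).
Context (idx_conv : forall a b c : P, (a <= b)%O -> (b <= c)%O ->
  idx a -> idx c -> idx b).

Definition zero_ext : pmod F P :=
  @PMod F d P (fun a => zobj (idx a))
    (fun a b ab => zmap (idx_mono ab))
    (fun a aa => zmap_id (idx_mono aa))
    (fun a b c ab bc ac =>
      zmap_comp (idx_mono ab) (idx_mono bc) (idx_mono ac) (idx_conv ab bc)).
End ZeroExtension.

Section Hat.
Context (F : fieldType) (m : nat) (M : pmod F 'I_m.+1).

Let bump_max (i : 'I_m.+1) : bump m.+1 i = i := lift_max i.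

Lemma hat_mono (i j : 'I_m.+2) : (i <= j)%O ->
  ole (unlift ord_max i) (unlift ord_max j).
Proof.
case: unliftP => [i'|] ->; case: unliftP => [j'|] -> //=.
by rewrite !leEord /= !bump_max.
Qed.

Lemma hat_conv (i j l : 'I_m.+2) : (i <= j)%O -> (j <= l)%O ->
  unlift ord_max i -> unlift ord_max l -> unlift ord_max j.
Proof.
move=> _; case: (unliftP ord_max l) => [l'|] -> //.
case: (unliftP ord_max j) => [j'|] -> //.
by rewrite leEord /= bump_max leqNgt ltn_ord.
Qed.

(* [unlift ord_max i] is [i] seen in [m], and is undefined at [i = m + 1]. *)
Definition hat : pmod F 'I_m.+2 :=
  zero_ext M (idx := unlift ord_max) hat_mono hat_conv.
End Hat.

Section Bar.
Context (F : fieldType) (R : realType) (m : nat) (M : pmod F 'I_m.+1).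
Context (iota : 'I_m.+2 -> R).

Definition last_le (a : R) : option 'I_m.+2 :=
  [pick i | (iota i <= a) && [forall j, (iota j <= a) ==> (j <= i)%N]].

Lemma last_leP (a : R) (i : 'I_m.+2) : iota i <= a ->
  exists2 j, last_le a = Some j & (i <= j)%N.
Proof.
move=> ia; rewrite /last_le; case: pickP => [j /andP[_ /forallP jmax]|none].
  by exists j => //; apply: (implyP (jmax i)).
case: (@arg_maxnP _ i (fun i => iota i <= a) (@nat_of_ord _) ia) => j ja jmax.
have /negP[] := negbT (none j); rewrite ja /=.
by apply/forallP => l; apply/implyP => /jmax.
Qed.

Lemma last_le_le (a : R) (i : 'I_m.+2) : last_le a = Some i -> iota i <= a.
Proof. by rewrite /last_le; case: pickP => // j /andP[ja _] [<-]. Qed.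

Lemma bar_mono (a b : R) : a <= b -> ole (last_le a) (last_le b).
Proof.
move=> ab; case ai: (last_le a) => [i|] //.
by have [j -> ij] := last_leP (le_trans (last_le_le ai) ab).
Qed.

Lemma bar_conv (a b c : R) : a <= b -> b <= c ->
  last_le a -> last_le c -> last_le b.
Proof.
move=> ab _; case ai: (last_le a) => [i|] // _ _.
by have [j -> _] := last_leP (le_trans (last_le_le ai) ab).
Qed.

Definition bar : pmod F R := zero_ext (hat M) (idx := last_le) bar_mono bar_conv.
End Bar.

(* The half-open intervals [lo, hi), lo < hi, of {0 < ... < n - 1}. *)
Record hitv (n : nat) := HItv {
  ends : 'I_n * 'I_n;
  ends_lt : (ends.1 < ends.2)%N }.

HB.instance Definition _ (n : nat) := [isSub for @ends n].
HB.instance Definition _ (n : nat) := [Finite of hitv n by <:].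

Section HItv.
Context (n : nat).
Implicit Types I J : hitv n.

Definition lo I : 'I_n := (ends I).1.
Definition hi I : 'I_n := (ends I).2.
Definition hset I : {set 'I_n} := [set x : 'I_n | (lo I <= x < hi I)%N].
Definition hle I J : bool := hset I \subset hset J.
Definition hlt I J : bool := (J != I) && hle I J.

Lemma hleP I J : hle I J = ((lo J <= lo I)%N && (hi I <= hi J)%N).
Proof.
case: I => -[a b] /= ab; case: J => -[c d] /= cd.
rewrite /hle /hset /lo /hi /=.
apply/fintype.subsetP/andP => [sub|[ca bd] x]; last first.
  rewrite !inE => /andP[ax xb].
  by rewrite (leq_trans ca ax) (leq_trans xb bd).
have := sub a; rewrite !inE leqnn ab => /(_ isT)/andP[ca _]; split=> //.
have b1 : (b.-1 < n)%N by apply: leq_ltn_trans (leq_pred _) (ltn_ord b).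
have b0 : (0 < b)%N by apply: leq_ltn_trans ab.
have := sub (Ordinal b1); rewrite !inE /= -ltnS !prednK //.
by rewrite ab leqnn => /(_ isT)/andP[_].
Qed.

Lemma hle_refl : reflexive hle. Proof. by move=> I; apply: fintype.subxx. Qed.

Lemma hle_anti : antisymmetric hle.
Proof.
move=> I J; rewrite !hleP => /andP[/andP[h1 h2] /andP[h3 h4]].
apply: val_inj; rewrite [LHS]surjective_pairing [RHS]surjective_pairing.
by congr pair; apply/val_inj/eqP; rewrite eqn_leq; apply/andP; split.
Qed.

Lemma hle_trans : transitive hle.
Proof. by move=> J I K; apply: fintype.subset_trans. Qed.

HB.instance Definition _ := Order.isPOrder.Build (Order.Disp tt tt) (hitv n)
  (fun I J => erefl (hlt I J)) hle_refl hle_anti hle_trans.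
End HItv.

(* The recursion defining the Moebius function, run for [#|T|] steps, which
   suffices by [moebius_lt]. *)
Section Moebius.
Context (d : Order.disp_t) (T : finPOrderType d).

Fixpoint moebius_rec (s : nat) (x y : T) : int :=
  if s is s'.+1 then
    if x == y then 1
    else if (x < y)%O then
      - \sum_(z : T | (x <= z)%O && (z < y)%O) moebius_rec s' x z
    else 0
  else 0.

Definition moebius (x y : T) : int := moebius_rec #|T| x y.

Lemma moebius_rec_stable (s s' : nat) (x y : T) :
  (#|[pred z | (z <= y)%O]| <= s)%N -> (#|[pred z | (z <= y)%O]| <= s')%N ->
  moebius_rec s x y = moebius_rec s' x y.
Proof.
have pos (u : T) : (0 < #|[pred z | (z <= u)%O]|)%N.
  by apply/card_gt0P; exists u; rewrite inE.
elim: s s' y => [|s IH] [|s'] y; rewrite ?leqn0.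
- by [].
- by move/eqP => e; have := pos y; rewrite e.
- by move=> _ /eqP e; have := pos y; rewrite e.
move=> hs hs' /=; case: ifP => // _; case: ifP => // _; congr (- _).
apply: eq_bigr => z /andP[_ zy].
have lt : (#|[pred w | (w <= z)%O]| < #|[pred w | (w <= y)%O]|)%N.
  apply: proper_card; apply/properP; split.
    by apply/fintype.subsetP => w; rewrite !inE => /le_trans; apply; apply: ltW.
  by exists y; rewrite !inE ?lexx // lt_geF.
by apply: IH; rewrite -ltnS; apply: leq_trans lt _.
Qed.

Lemma moebius_refl (x : T) : moebius x x = 1.
Proof.
rewrite /moebius; have : (0 < #|T|)%N by apply/card_gt0P; exists x.
by case: #|T| => //= s; rewrite eqxx.
Qed.

Lemma moebius_lt (x y : T) : (x < y)%O ->
  moebius x y = - \sum_(z : T | (x <= z)%O && (z < y)%O) moebius x z.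
Proof.
move=> xy; transitivity (moebius_rec #|T|.+1 x y).
  by apply: moebius_rec_stable; [|apply: leqW]; apply: max_card.
by rewrite /= (lt_eqF xy) xy.
Qed.
End Moebius.

Definition u_ (k n : nat) : nat := (k <= n)%N.

Section FiniteRank.
Context (F : fieldType) (m : nat) (M : pmod F 'I_m.+1).

Lemma hitv_inord_le (I : hitv m.+2) :
  ((inord (lo I) : 'I_m.+1) <= (inord (hi I).-1 : 'I_m.+1))%O.
Proof.
case: I => -[a b] /= ab; rewrite /lo /hi /= leEord.
have bm := ltn_ord b; rewrite /= in ab *.
have b0 : (0 < b)%N by apply: leq_ltn_trans ab.
have ab1 : (a <= b.-1)%N by rewrite -ltnS prednK.
have b1 : (b.-1 < m.+1)%N by rewrite prednK // -ltnS.
by rewrite !inordK // (leq_ltn_trans ab1).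
Qed.

Definition Rank (I : hitv m.+2) : nat := lrank (pmap M (hitv_inord_le I)).

Definition Rank_k (k : nat) (I : hitv m.+2) : nat := u_ k (Rank I).

Definition PD (k : nat) (I : hitv m.+2) : int :=
  \sum_(J : hitv m.+2 | (I <= J)%O) moebius I J * (Rank_k k J)%:Z.
End FiniteRank.

Definition nat_min (A : set nat) : nat :=
  xget 0%N [set n | A n /\ forall j, A j -> (n <= j)%N]%classic.

(* Functions on the half-open intervals [a, b) of the real line take the two
   endpoints as arguments and are only meaningful for [a < b]. *)

Section RealRank.
Context (F : fieldType) (R : realType).

Definition RankR (M : pmod F R) (a b : R) : nat :=
  nat_min [set n | exists (c : R) (ac : a <= c), c < b /\ lrank (pmap M ac) = n]%classic.

Definition RankR_k (M : pmod F R) (k : nat) (a b : R) : nat :=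
  u_ k (RankR M a b).

Definition PD_bar (m : nat) (M : pmod F 'I_m.+1) (iota : 'I_m.+2 -> R)
    (k : nat) (a b : R) : int :=
  if [pick J : hitv m.+2 | (iota (lo J) == a) && (iota (hi J) == b)]
    is Some J then PD M k J else 0.

(* [sup] is [0] on the empty set. *)
Definition landscape (M : pmod F R) (k : nat) (t : R) : R :=
  sup [set h | 0 < h /\ RankR_k M k (t - h) (t + h) = 1%N]%classic.
End RealRank.

Section RealFunctions.
Context (R : realType).

Definition piecewise_linear (f : R -> R) : Prop :=
  exists s : seq R, forall i : interval R, (forall x, x \in s -> x \notin i) ->
    exists c e : R, forall x, x \in i -> f x = c * x + e.

Definition local_max (f : R -> R) (t : R) : Prop :=
  \forall s \near t, f s <= f t.

Definition local_min (f : R -> R) (t : R) : Prop :=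
  \forall s \near t, f t <= f s.
End RealFunctions.

(* Main.v *)
Require Import Defs.
From mathcomp Require Import all_boot all_order all_algebra.
From mathcomp Require Import all_classical all_reals all_analysis.
From mathcomp Require Import lra.

Set Implicit Arguments.
Unset Strict Implicit.
Unset Printing Implicit Defensive.

Import Order.TTheory GRing.Theory Num.Theory.
Import numFieldNormedType.Exports.

Local Open Scope ring_scope.

(** Call an interval [J] of the grid persistent when its rank is at least [k].
    Ranks decrease when an interval grows, so the persistent intervals form a
    down-set, and unfolding the extension of [M] to the real line shows that
    [RankR_k] is [1] on [[a, b)] exactly when some persistent [J] satisfies
    [iota (lo J) <= a] and [b <= iota (hi J)] ([RankR_k_barP]). Hence the
    landscape is the upper envelope of finitely many tents: at [t] it is the
    maximum of [0] and of all [min (t - iota (lo J)) (iota (hi J) - t)], with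
    [J] persistent ([landscape_tents]).

    The analytic part concerns such envelopes only. They are built from finitely
    many affine functions by min and max, hence are piecewise linear, and they
    are 1-Lipschitz. The local shape at a point [t] of height [h > 0] is read
    off the active intervals, the persistent ones that contain [[t - h, t + h)].
    As there are finitely many intervals, those active at [s] are already active
    at [t] for all [s] near [t] ([active_near]). An active interval that starts
    strictly before [t - h] forces slope [-1] on the left of [t], and one that
    ends strictly after [t + h] forces slope [1] on the right. Thus [t] is a
    local maximum when neither kind exists and a local minimum when both do. If
    neither kind exists there is a corner, [h - |s - t|]; otherwise a derivative
    at [t], if there is one, is [1] or [-1].

    The combinatorial part identifies these alternatives with the graded
    persistence diagram. The Moebius function of the interval poset is supported
    on the four intervals obtained by moving each end outwards by at most one
    step, so [PD] at [I] is the inclusion-exclusion count [1 - A - B + C], where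
    [A], [B], [C] tell whether a persistent interval extends a persistent [I]
    strictly on the left, on the right, or on both sides ([PD_grown]). As
    [C] implies [A] and [B], the value is [1] exactly when [I] is a maximal
    persistent interval, and [-1] exactly when [A] and [B] hold without [C].
    With [I] having ends [t - h] and [t + h], these are the two alternatives
    above. *)

(** * Ranks of the extended module *)

Section Ranks.
Context {F : fieldType}.

Lemma lrank0 (U V : vectType F) : lrank (0 : 'Hom(U, V)) = 0%N.
Proof. by rewrite /lrank lim0g dimv0. Qed.

Lemma lrank_comp_r (U V W : vectType F) (f : 'Hom(U, V)) (g : 'Hom(V, W)) :
  (lrank (g \o f)%VF <= lrank f)%N.
Proof.
by rewrite /lrank limg_comp -(limg_ker_dim g (limg f)) leq_addl.
Qed.

Lemma lrank_comp_l (U V W : vectType F) (f : 'Hom(U, V)) (g : 'Hom(V, W)) :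
  (lrank (g \o f)%VF <= lrank g)%N.
Proof. by rewrite /lrank limg_comp dimvS // limgS // subvf. Qed.

Lemma lrank_pmap_mono {d : Order.disp_t} {P : porderType d} (M : pmod F P)
    (x y z w : P) (xw : (x <= w)%O) (yz : (y <= z)%O) :
  (x <= y)%O -> (z <= w)%O -> (lrank (Defs.pmap M xw) <= lrank (Defs.pmap M yz))%N.
Proof.
move=> xy zw; have xz := le_trans xy yz.
rewrite (pmap_comp M xz zw xw); apply: leq_trans (lrank_comp_r _ _) _.
by rewrite (pmap_comp M xy yz xz); apply: lrank_comp_l.
Qed.

(** Since [1 <= k], a rank of at least [k] already forces both ends to lie where
    the module is not extended by zero; this removes the dependent types. *)
Lemma lrank_zmap_geP {d : Order.disp_t} {Q : porderType d} (M : pmod F Q)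
    (k : nat) (o o' : option Q) (oo' : ole o o') : (1 <= k)%N ->
  (k <= lrank (zmap M oo'))%N <->
  exists q q' (qq' : (q <= q')%O),
    [/\ o = Some q, o' = Some q' & (k <= lrank (Defs.pmap M qq'))%N].
Proof.
move=> k1; split.
- case: o oo' => [q|]; case: o' => [q'|] //= oo';
    try by rewrite lrank0 leqNgt k1.
  by move=> kq; exists q, q', oo'.
- move=> [q [q' [qq' [oq oq' kq]]]]; subst o o' => /=.
  by rewrite (bool_irrelevance oo' qq').
Qed.

End Ranks.

Section BarRank.
Context {F : fieldType} {R : realType} {m : nat} (M : pmod F 'I_m.+1).
Variable iota : 'I_m.+2 -> R.
Hypothesis iota_inj : injective iota.
Hypothesis iota_homo : forall i j : 'I_m.+2, (i <= j)%N -> iota i <= iota j.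

Lemma iota_le i j : (iota i <= iota j) = (i <= j)%N.
Proof.
apply/idP/idP => [ij|]; last exact: iota_homo.
rewrite leqNgt; apply/negP => ji; have := iota_homo (ltnW ji) => ji'.
have /iota_inj e : iota i = iota j by apply/eqP; rewrite eq_le ij.
by rewrite e ltnn in ji.
Qed.

Lemma iota_lt i j : (iota i < iota j) = (i < j)%N.
Proof. by rewrite ltNge iota_le ltnNge. Qed.

Lemma Rank_mono (I J : hitv m.+2) : (I <= J)%O -> (Rank M J <= Rank M I)%N.
Proof.
have := ends_lt I; have := ends_lt J; rewrite /Order.le /= hleP -/(lo _) -/(hi _).
move=> Jlt Ilt /andP[l h]; rewrite /Rank.
have bnd (i : 'I_m.+2) : (i.-1 < m.+1)%N by case: i => -[].
have Jlo : (lo J < m.+1)%N by apply: leq_trans Jlt _; rewrite -ltnS ltn_ord.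
have Ilo : (lo I < m.+1)%N by apply: leq_trans Ilt _; rewrite -ltnS ltn_ord.
apply: lrank_pmap_mono; rewrite leEord /= !inordK //.
by rewrite -!subn1 leq_sub2r.
Qed.

Lemma lrank_bar_geP (k : nat) (a c : R) (ac : a <= c) : (1 <= k)%N ->
  (k <= lrank (Defs.pmap (bar M iota) ac))%N <->
  exists i j : 'I_m.+2, exists (i' j' : 'I_m.+1) (ij : (i' <= j')%O),
    [/\ last_le iota a = Some i, last_le iota c = Some j,
        i = i' :> nat, j = j' :> nat & (k <= lrank (Defs.pmap M ij))%N].
Proof.
move=> k1; rewrite (lrank_zmap_geP (hat M)) //.
split => [[i [j [ij [ai cj]]]]|[i [j [i' [j' [ij [ai cj ii jj kr]]]]]]].
- rewrite (lrank_zmap_geP M) // => -[i' [j' [ij' [ii jj kr]]]].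
  exists i, j, i', j', ij'; split=> //.
    by case: unliftP ii => // u -> [<-]; rewrite lift_max.
  by case: unliftP jj => // u -> [<-]; rewrite lift_max.
- have ij0 : (i <= j)%O by rewrite leEord ii jj; exact: ij.
  exists i, j, ij0; split=> //.
  rewrite (lrank_zmap_geP M) //; exists i', j', ij; split=> //.
    by rewrite (_ : i = lift ord_max i') ?liftK //; apply: val_inj; rewrite /= [RHS]lift_max.
  by rewrite (_ : j = lift ord_max j') ?liftK //; apply: val_inj; rewrite /= [RHS]lift_max.
Qed.

Lemma nat_min_geP (A : set nat) (k : nat) : (exists n, A n) ->
  (k <= nat_min A)%N <-> forall n, A n -> (k <= n)%N.
Proof.
move=> exA; rewrite /nat_min; case: xgetP => [n _ [An nmin]|none].
  by split => [kn j /nmin|]; [exact: leq_trans|apply].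
have [n /asboolP An nmin] := @ex_minnP (fun n => `[< A n >])
  (let: ex_intro n An := exA in ex_intro _ n (asboolT An)).
by have [] := none n; split=> // j /asboolT/nmin.
Qed.

Lemma RankR_k_geP (N : pmod F R) (k : nat) (a b : R) : a < b ->
  RankR_k N k a b = 1%N <->
  forall (c : R) (ac : a <= c), c < b -> (k <= lrank (Defs.pmap N ac))%N.
Proof.
move=> ab; rewrite /RankR_k /u_ -[X in (k <= X)%N]/(nat_min _).
have -> : forall B : bool, (B = 1%N :> nat) <-> B by case.
rewrite nat_min_geP.
  by split => [ge c ac cb|ge n [c [ac [cb <-]]]]; [apply: ge; exists c, ac|exact: ge].
by exists (lrank (Defs.pmap N (lexx a))), a, (lexx a).
Qed.

(** The minimum over [c] in [[a, b)] is the rank from the last grid point [i] before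
    [a] to the last grid point [j] strictly before [b], so [[i, j + 1)] is a grid
    interval that covers [[a, b)] and has the same rank. *)
Lemma RankR_k_barP (k : nat) (a b : R) : (1 <= k)%N -> a < b ->
  RankR_k (bar M iota) k a b = 1%N <->
  exists J : hitv m.+2,
    [/\ (k <= Rank M J)%N, iota (lo J) <= a & b <= iota (hi J)].
Proof.
move=> k1 ab; rewrite RankR_k_geP //; split => [ge|[J [kJ aJ bJ]] c ac cb].
- have /lrank_bar_geP-/(_ k1)[i [_ [_ [_ [_ [ai _ _ _ _]]]]]] := ge a (lexx a) ab.
  have ia := last_le_le ai.
  have ib : iota i < b by apply: le_lt_trans ab.
  (* If [iota j] lies before [a], then [j = i] and the rank is attained at [a]. *)
  have [j jb jmax] := @arg_maxnP _ i (fun j => iota j < b) (@nat_of_ord _) ib.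
  pose c := Num.max a (iota j).
  have ac : a <= c by rewrite le_max lexx.
  have cb : c < b by rewrite gt_max ab.
  have /lrank_bar_geP-/(_ k1)[i0 [j0 [i' [j' [ij [ai0 cj ii jj kr]]]]]] := ge c ac cb.
  move: ai0; rewrite ai => -[i0i]; subst i0.
  have jc : iota j <= c by rewrite le_max lexx orbT.
  have j0j : j0 = j.
    apply: val_inj; apply/eqP; rewrite eqn_leq; apply/andP; split.
      by apply: jmax; apply: le_lt_trans cb; exact: last_le_le.
    by have [l] := last_leP jc; rewrite cj => -[<-].
  subst j0.
  have jm : (j.+1 < m.+2)%N by rewrite jj ltnS ltn_ord.
  have iJ : (i < j.+1)%N by rewrite ltnS ii jj; exact: ij.
  exists (@HItv m.+2 (i, Ordinal jm) iJ); split=> //; last first.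
    rewrite leNgt; apply/negP => lt.
    by have := jmax _ lt; rewrite /= ltnn.
  apply: leq_trans kr _; apply: lrank_pmap_mono; rewrite leEord /lo /hi /=.
    by rewrite inordK ?ii.
  by rewrite inordK jj.
- apply/lrank_bar_geP => //.
  have [i ai Ji] := last_leP aJ; have [j cj ij] := last_leP (le_trans (last_le_le ai) ac).
  have jJ : (j < hi J)%N.
    by rewrite -iota_lt; apply: le_lt_trans (last_le_le cj) _; apply: lt_le_trans bJ.
  have jm : (j < m.+1)%N by apply: leq_trans jJ _; rewrite -ltnS ltn_ord.
  have im : (i < m.+1)%N by apply: leq_ltn_trans jm.
  exists i, j, (Ordinal im), (Ordinal jm), ij; split=> //.
  apply: leq_trans kJ _; apply: lrank_pmap_mono; rewrite leEord /=.
    by rewrite inordK // (leq_ltn_trans Ji).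
  have hiJ := ltn_ord (hi J).
  by rewrite inordK -ltnS prednK //; apply: leq_ltn_trans jJ.
Qed.

End BarRank.

(** * Piecewise linearity of lattice polynomials in affine functions *)

Section LatticeAffine.
Context {R : realType}.
Implicit Types (p q : R * R) (L : seq (R * R)) (f g : R -> R) (i : interval R).

Definition affine p (x : R) : R := p.1 * x + p.2.

(** The abscissa where two lines of distinct slopes meet; parallel lines,
    for which the division by zero gives [0], are ordered everywhere anyway. *)
Definition crossing p q : R := (q.2 - p.2) / (p.1 - q.1).

Lemma affine_comparable p q i : crossing p q \notin i ->
  {in i, forall x, affine p x <= affine q x} \/
  {in i, forall x, affine q x <= affine p x}.
Proof.
move=> ri.
have [e1|n1] := eqVneq p.1 q.1.
  by case: (leP p.2 q.2) => h; [left|right] => x _; rewrite /affine e1; lra.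
have {ri} side : {in i, forall x, x < crossing p q} \/
    {in i, forall x, crossing p q < x}.
  have [|none] := pselect (exists2 x, x \in i & x < crossing p q).
    case=> x xi xr; left => y yi; rewrite ltNge; apply/negP => ry.
    move/negP: ri; apply.
    have xy : x <= y by apply: le_trans ry; apply: ltW.
    by apply: (interval_is_interval xi yi); rewrite (ltW xr) ry.
  right => x xi; rewrite ltNge; apply/negP; rewrite le_eqVlt => /orP[/eqP xr|xr].
    by rewrite -xr xi in ri.
  by apply: none; exists x.
have d0 : p.1 - q.1 != 0 by rewrite subr_eq0.
have diff x : affine p x - affine q x = (p.1 - q.1) * (x - crossing p q).
  rewrite /crossing mulrBr [_ * (_ / _)]mulrC divfK // /affine; lra.
have cmp x : (affine p x <= affine q x) = ((p.1 - q.1) * (x - crossing p q) <= 0).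
  by rewrite -diff subr_le0.
have cmp' x : (affine q x <= affine p x) = (0 <= (p.1 - q.1) * (x - crossing p q)).
  by rewrite -diff subr_ge0.
case: (ltP 0 (p.1 - q.1)) => s; case: side => side.
- by left => x /side xr; rewrite cmp; nra.
- by right => x /side xr; rewrite cmp'; nra.
- by right => x /side xr; rewrite cmp'; nra.
- by left => x /side xr; rewrite cmp; nra.
Qed.

Inductive lattice_affine L : (R -> R) -> Prop :=
| LatticeAffine p : p \in L -> lattice_affine L (affine p)
| LatticeMin f g : lattice_affine L f -> lattice_affine L g ->
    lattice_affine L (fun x => Num.min (f x) (g x))
| LatticeMax f g : lattice_affine L f -> lattice_affine L g ->
    lattice_affine L (fun x => Num.max (f x) (g x)).

(** On an interval that avoids all crossings, any two of the lines are ordered in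
    the same way throughout, so every min or max is one of its arguments. *)
Lemma lattice_affine_piecewise_linear L f :
  lattice_affine L f -> piecewise_linear f.
Proof.
move=> Lf; exists [seq crossing p q | p <- L, q <- L] => i avoid.
have cmp p q : p \in L -> q \in L ->
    {in i, forall x, affine p x <= affine q x} \/
    {in i, forall x, affine q x <= affine p x}.
  by move=> pL qL; apply/affine_comparable/avoid/allpairs_f.
suff [p _ fp] : exists2 p, p \in L & {in i, f =1 affine p}.
  by exists p.1, p.2.
elim: Lf => {f} [p pL|f g _ [p pL fp] _ [q qL gq]|f g _ [p pL fp] _ [q qL gq]].
- by exists p.
- have [pq|qp] := cmp p q pL qL.
    by exists p => // x xi; rewrite (fp x) // (gq x) // min_l // pq.
  by exists q => // x xi; rewrite (fp x) // (gq x) // min_r // qp.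
- have [pq|qp] := cmp p q pL qL.
    by exists q => // x xi; rewrite (fp x) // (gq x) // max_r // pq.
  by exists p => // x xi; rewrite (fp x) // (gq x) // max_l // qp.
Qed.
End LatticeAffine.

(** * One-sided growth bounds on a derivative *)

Section DirectionalBounds.
Context {R : realType}.
Implicit Types (f : R -> R) (t c d : R).

(** The factor [c] is used as a sign: [c = 1] approaches [t] from the right and
    [c = -1] from the left. *)
Lemma derive1_dir_cvg f t c : derivable f t 1 ->
  (e^-1 * (f (t + c * e) - f t) @[e --> 0^'+] --> c * derive1 f t)%classic.
Proof.
move=> /derivable1_diffP df.
have -> : c * derive1 f t = 'D_c f t.
  rewrite derive1E !deriveE // -[X in _ = _ X]mulr1 -[c * 1]/(c *: (1 : R)).
  by rewrite linearZ.
have dfc : derivable f t c by exact: diff_derivable.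
apply: cvg_dnbhs_at_right; rewrite (_ : (fun e : R => e^-1 * (f (t + c * e) - f t))
  = fun e : R => e^-1 *: ((f \o shift t) (e *: c) - f t)) //.
by apply: funext => e; rewrite /= [e *: c + t]addrC -[e *: c]/(e * c) [e * c]mulrC.
Qed.

Lemma derive1_dir_le f t c d : derivable f t 1 ->
  (\forall e \near 0^'+%classic, f (t + c * e) <= f t + d * e) ->
  c * derive1 f t <= d.
Proof.
move=> df le.
apply: cvgr_to_le (derive1_dir_cvg df) _.
near=> e; have e0 : 0 < e by [].
rewrite ler_pdivrMl // lerBlDl [e * d]mulrC; near: e; exact: le.
Unshelve. all: by end_near. Qed.

Lemma derive1_dir_ge f t c d : derivable f t 1 ->
  (\forall e \near 0^'+%classic, f t + d * e <= f (t + c * e)) ->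
  d <= c * derive1 f t.
Proof.
move=> df le.
apply: cvgr_to_ge (derive1_dir_cvg df) _.
near=> e; have e0 : 0 < e by [].
rewrite ler_pdivlMl // lerBrDl [e * d]mulrC; near: e; exact: le.
Unshelve. all: by end_near. Qed.
End DirectionalBounds.

(** * Upper envelopes of finitely many tents *)

Section Tents.
Context {R : realType} {T : finType}.
Variables (G : pred T) (a b : T -> R).
Implicit Types (s t h e : R) (J : T).

Definition tents t : R := \big[Num.max/0]_(J | G J) Num.min (t - a J) (b J - t).

Lemma tents_ge0 t : 0 <= tents t.
Proof. exact: bigmax_ge_id. Qed.

Lemma tents_geP t h : 0 < h ->
  reflect (exists J, [/\ G J, a J <= t - h & t + h <= b J]) (h <= tents t).
Proof.
move=> h0; apply: (iffP (bigmax_geP _ _ _ _)) => [[h0'|[J GJ]]|[J [GJ aJ bJ]]].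
- by rewrite leNgt h0 in h0'.
- by rewrite le_min => /andP[aJ bJ]; exists J; split => //; lra.
- by right; exists J => //; rewrite le_min; apply/andP; split; lra.
Qed.

(** An interval that witnesses height [h] at [s] contains the interval of radius
    [h - |s - t|] around [t]. *)
Lemma tents_lipschitz s t : tents s <= tents t + `|s - t|.
Proof.
rewrite leNgt; apply/negP => lt.
have t0 := tents_ge0 t; have n0 := normr_ge0 (s - t).
have s0 : 0 < tents s by lra.
have /tents_geP-/(_ s0)[J [GJ aJ bJ]] := lexx (tents s).
suff : tents s - `|s - t| <= tents t by lra.
apply/tents_geP; first by lra.
have n1 := ler_norm (s - t); have n2 := ler_norm (t - s); rewrite distrC in n2.
by exists J; split => //; lra.
Qed.

Lemma tents_continuous : continuous tents.
Proof.
move=> t; apply/cvgrPdist_le => e e0; near=> s.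
have st : `|t - s| <= e by near: s; apply: cvgr_dist_le.
have l1 := tents_lipschitz s t; have l2 := tents_lipschitz t s.
rewrite distrC in l1; rewrite ler_norml; apply/andP; split; lra.
Unshelve. all: by end_near. Qed.

Lemma tents_piecewise_linear : piecewise_linear tents.
Proof.
pose L : seq (R * R) := (0, 0) :: [seq (1, - a J) | J : T] ++ [seq (-1, b J) | J : T].
apply: (@lattice_affine_piecewise_linear _ L).
have -> : tents = fun t =>
    \big[Num.max/affine (0, 0) t]_(J <- index_enum T | G J)
      Num.min (affine (1, - a J) t) (affine (-1, b J) t).
  apply/funext => t; rewrite /tents /affine /= mul0r addr0.
  by apply: eq_bigr => J _; rewrite mul1r mulN1r addrC [b J - t]addrC.
elim: (index_enum T) => [|J r IH].
  rewrite (_ : (fun _ => _) = affine (0, 0)); last first.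
    by apply/funext => t; rewrite big_nil.
  by apply: LatticeAffine; rewrite inE eqxx.
under eq_fun do rewrite big_cons; case: (G J) => //.
apply: LatticeMax => //; apply: LatticeMin; apply: LatticeAffine;
  rewrite inE mem_cat; apply/orP; right; apply/orP; [left|right];
  by apply/mapP; exists J; rewrite ?mem_enum.
Qed.

(** For positive height, these are the indices whose tent realises the envelope
    at [t]. *)
Definition active t J : Prop :=
  [/\ G J, a J <= t - tents t & t + tents t <= b J].

Lemma active_ex t : 0 < tents t -> exists J, active t J.
Proof. by move=> t0; apply/tents_geP. Qed.

(** Inactivity at [t] is a strict inequality between continuous functions, hence
    persists near [t], uniformly over the finite index type. *)
Lemma active_near t :
  \forall s \near t, forall J, active s J -> active t J.
Proof.
apply: (@filter_forall R T (fun J s => active s J -> active t J) (nbhs t)) => J; rewrite /active.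
have [aJ|aJ] := leP (a J) (t - tents t); last first.
  have : (s - tents s @[s --> t] --> t - tents t)%classic.
    by apply: cvgB; [exact: cvg_id|exact: tents_continuous].
  by move=> /cvgr_lt/(_ _ aJ); apply: filterS => s lt [_]; rewrite leNgt lt.
have [bJ|bJ] := leP (t + tents t) (b J); last first.
  have : (s + tents s @[s --> t] --> t + tents t)%classic.
    by apply: cvgD; [exact: cvg_id|exact: tents_continuous].
  by move=> /cvgr_gt/(_ _ bJ); apply: filterS => s lt [_ _]; rewrite leNgt lt.
by near=> s => -[].
Unshelve. all: by end_near. Qed.

(** Such an interval would allow a larger radius around [t]. *)
Lemma tents_not_inner t J : G J -> ~ (a J < t - tents t /\ t + tents t < b J).
Proof.
move=> GJ [aJ bJ]; have t0 := tents_ge0 t.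
pose h := Num.min (t - a J) (b J - t).
have h1 : tents t < h by rewrite lt_min; apply/andP; split; lra.
suff : h <= tents t by lra.
apply/tents_geP; first by lra.
have [h2 h3] : h <= t - a J /\ h <= b J - t by rewrite /h !ge_min !lexx orbT.
by exists J; split => //; lra.
Qed.

Definition peaks_at t J : Prop := a J = t - tents t /\ b J = t + tents t.

Lemma tents_increase_left t J : active t J -> a J < t - tents t ->
  \forall e \near 0^'+%classic, tents t + e <= tents (t - e).
Proof.
move=> [GJ aJ bJ] lt; have t0 := tents_ge0 t.
near=> e.
have e0 : 0 < e by [].
have e1 : e <= (t - tents t - a J) / 2.
  by near: e; apply: nbhs_right_le; lra.
by apply/tents_geP; [lra|exists J; split => //; lra].
Unshelve. all: by end_near. Qed.

Lemma tents_increase_right t J : active t J -> t + tents t < b J ->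
  \forall e \near 0^'+%classic, tents t + e <= tents (t + e).
Proof.
move=> [GJ aJ bJ] lt; have t0 := tents_ge0 t.
near=> e.
have e0 : 0 < e by [].
have e1 : e <= (b J - t - tents t) / 2.
  by near: e; apply: nbhs_right_le; lra.
by apply/tents_geP; [lra|exists J; split => //; lra].
Unshelve. all: by end_near. Qed.

(** Near [t] the height at [s] comes from an index that is active at [t] as well,
    and the tent of that index peaks at [t]. *)
Lemma tents_peak t : 0 < tents t -> (forall J, active t J -> peaks_at t J) ->
  \forall s \near t, tents s <= tents t - `|s - t|.
Proof.
move=> t0 peak; near=> s.
have s0 : 0 < tents s.
  by near: s; apply: (cvgr_gt (tents t)) t0; apply: tents_continuous.
have act : forall J, active s J -> active t J by near: s; exact: active_near.
have [J sJ] := active_ex s0; have tJ := act J sJ.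
have [aJ bJ] := peak J tJ; case: sJ; rewrite aJ bJ => _ a1 b1.
suff : `|s - t| <= tents t - tents s by lra.
by rewrite ler_norml; apply/andP; split; lra.
Unshelve. all: by end_near. Qed.

Lemma near_0_right_shift (t c : R) (P : R -> Prop) :
  (\forall s \near t, P s) -> \forall e \near 0^'+%classic, P (t + c * e).
Proof.
move=> tP; apply: cvg_within.
have lim : (t + c * e @[e --> (0 : R)] --> t + c * 0)%classic.
  by apply: cvgD; [exact: cvg_cst|apply: cvgMr; exact: cvg_id].
by apply: lim; rewrite mulr0 addr0.
Qed.

(** A side on which an active interval reaches beyond distance [h] is a side on
    which the envelope grows at unit speed. *)
Lemma tents_local_maxP t : 0 < tents t ->
  local_max tents t <-> (forall J, active t J -> peaks_at t J).
Proof.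
move=> t0; split => [tmax J tJ|peak]; last first.
  apply: filterS (tents_peak t0 peak) => s.
  by have := normr_ge0 (s - t); lra.
case: (tJ) => GJ aJ bJ; split; apply/eqP; rewrite eq_le; apply/andP; split=> //.
- rewrite leNgt; apply/negP => lt; have lt' := tents_increase_left tJ lt.
  near (0 : R)^'+%classic => e.
  have e0 : 0 < e by [].
  have h1 : tents t + e <= tents (t - e) by near: e.
  have h2 : tents (t + (-1) * e) <= tents t.
    by near: e; apply: (@near_0_right_shift t (-1) (fun s => tents s <= tents t)).
  by rewrite mulN1r in h2; lra.
- rewrite leNgt; apply/negP => lt; have lt' := tents_increase_right tJ lt.
  near (0 : R)^'+%classic => e.
  have e0 : 0 < e by [].
  have h1 : tents t + e <= tents (t + e) by near: e.
  have h2 : tents (t + 1 * e) <= tents t.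
    by near: e; apply: (@near_0_right_shift t 1 (fun s => tents s <= tents t)).
  by rewrite mul1r in h2; lra.
Unshelve. all: by end_near. Qed.

(** An index active at some [s < t] near [t] of height at least [h] starts before
    [s - h], so strictly before [t - h], and is active at [t] too; the right side
    is symmetric. *)
Lemma tents_local_minP t : 0 < tents t ->
  local_min tents t <->
  (exists2 J, active t J & a J < t - tents t) /\
  (exists2 J, active t J & t + tents t < b J).
Proof.
move=> t0; split => [tmin|[[J [GJ aJ bJ] lt] [K [GK aK bK] lt']]].
- have both (c : R) : \forall e \near 0^'+%classic, tents t <= tents (t + c * e) /\
      (forall J, active (t + c * e) J -> active t J).
    apply: (@near_0_right_shift t c (fun s => tents t <= tents s /\
      forall J, active s J -> active t J)).
    by apply: filterI => //; exact: active_near.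
  split.
    near (0 : R)^'+%classic => e.
    have e0 : 0 < e by [].
    have [le act] : tents t <= tents (t + (-1) * e) /\
      (forall J, active (t + (-1) * e) J -> active t J) by near: e; exact: both.
    have [|J sJ] := @active_ex (t + (-1) * e); first by lra.
    by exists J; [exact: act|case: sJ => _; lra].
  near (0 : R)^'+%classic => e.
  have e0 : 0 < e by [].
  have [le act] : tents t <= tents (t + 1 * e) /\
    (forall J, active (t + 1 * e) J -> active t J) by near: e; exact: both.
  have [|J sJ] := @active_ex (t + 1 * e); first by lra.
  by exists J; [exact: act|case: sJ => _; lra].
- near=> s.
  apply/tents_geP => //; have [st|ts] := leP s t.
    exists J; split => //; last by lra.
    suff : a J + tents t <= s by lra.
    by near: s; apply: (cvgr_ge t); [exact: cvg_id|lra].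
  exists K; split => //; first by lra.
  suff : s <= b K - tents t by lra.
  by near: s; apply: (cvgr_le t); [exact: cvg_id|lra].
Unshelve. all: by end_near. Qed.

(** The Lipschitz bound gives [|d| <= 1] for the derivative [d]. Unit growth on
    one side forces equality; without it [t] is a peak, where the two one-sided
    slopes [-1] and [1] would both have to equal [d]. *)
Lemma tents_derive1 t : derivable tents t 1 -> 0 < tents t ->
  derive1 tents t = -1 \/ derive1 tents t = 1.
Proof.
move=> dt t0.
have lip (c : R) : `|c| = 1 -> c * derive1 tents t <= 1.
  move=> c1; apply: derive1_dir_le dt _; near=> e.
  have e0 : 0 < e by [].
  have := tents_lipschitz (t + c * e) t.
  by rewrite [X in `|X - _|]addrC addrK normrM c1 (gtr0_norm e0).
have l1 := lip 1 (normr1 _).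
have l2 : -1 * derive1 tents t <= 1 by apply: lip; rewrite normrN1.
have [[J tJ aJ]|noleft] := pselect (exists2 J, active t J & a J < t - tents t).
  left; suff : 1 <= -1 * derive1 tents t by lra.
  apply: derive1_dir_ge dt _; apply: filterS (tents_increase_left tJ aJ) => e.
  by rewrite mulN1r mul1r.
have [[J tJ bJ]|noright] := pselect (exists2 J, active t J & t + tents t < b J).
  right; suff : 1 <= 1 * derive1 tents t by lra.
  apply: derive1_dir_ge dt _; apply: filterS (tents_increase_right tJ bJ) => e.
  by rewrite !mul1r.
have peak J : active t J -> peaks_at t J.
  move=> tJ; case: (tJ) => _ aJ bJ; split; apply/eqP; rewrite eq_le.
    by rewrite aJ leNgt; apply/negP => lt; apply: noleft; exists J.
  by rewrite bJ andbT leNgt; apply/negP => lt; apply: noright; exists J.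
have down (c : R) : `|c| = 1 -> c * derive1 tents t <= -1.
  move=> c1; apply: derive1_dir_le dt _; near=> e.
  have e0 : 0 < e by [].
  suff : tents (t + c * e) <= tents t - `|t + c * e - t|.
    by rewrite [t + _]addrC addrK normrM c1 (gtr0_norm e0) mulN1r mul1r.
  near: e.
  apply: (@near_0_right_shift t c (fun s => tents s <= tents t - `|s - t|)).
  exact: tents_peak.
have d1 := down 1 (normr1 _).
have d2 : -1 * derive1 tents t <= -1 by apply: down; rewrite normrN1.
lra.
Unshelve. all: by end_near. Qed.

(** A zero of a nonnegative function is a minimum. *)
Lemma tents_derive1_eq0 t : derivable tents t 1 -> tents t = 0 ->
  derive1 tents t = 0.
Proof.
move=> dt t0.
have ge0 (c : R) : 0 <= c * derive1 tents t.
  apply: derive1_dir_ge dt _; near=> e; rewrite mul0r addr0 t0; exact: tents_ge0.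
by have := ge0 1; have := ge0 (-1); lra.
Unshelve. all: by end_near. Qed.

End Tents.

(** * Moebius function of the poset of grid intervals *)

Section MoebiusInversion.
Context {d : Order.disp_t} {T : finPOrderType d}.

(** The recursion for the Moebius function is equivalent to the vanishing of its
    sums over the nontrivial intervals [[x, y]], and determines it. *)
Lemma moebius_unique (x : T) (nu : T -> int) : nu x = 1 ->
  (forall y, (x < y)%O -> \sum_(z | (x <= z <= y)%O) nu z = 0) ->
  forall y, (x <= y)%O -> moebius x y = nu y.
Proof.
move=> nux nu0 y.
have [n] := ubnP #|[pred z | (z <= y)%O]|; elim: n y => // n IH y yn.
rewrite le_eqVlt => /predU1P[<-|xy]; first by rewrite moebius_refl nux.
have := nu0 y xy; rewrite (bigD1 y) ?lexx ?(ltW xy) //= => /eqP.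
rewrite addr_eq0 => /eqP ->; rewrite moebius_lt //; congr (- _).
have eqc z : ((x <= z <= y)%O && (z != y)) = ((x <= z)%O && (z < y)%O).
  by rewrite lt_neqAle andbA [RHS]andbAC.
rewrite (eq_bigl _ _ eqc); apply: eq_bigr => z /andP[xz zy]; apply: IH => //.
rewrite -ltnS; apply: leq_trans yn; rewrite ltnS.
apply: proper_card; apply/properP; split.
  by apply/fintype.subsetP => w; rewrite !inE => /le_trans; apply; apply: ltW.
by exists y; rewrite !inE ?lexx // lt_geF.
Qed.
End MoebiusInversion.

Section IntervalMoebius.
Context {n : nat}.
Implicit Types (I J z : hitv n) (P : pred (hitv n)).

(** The flags tell whether the left, resp. the right, end has to move strictly;
    [neighbour] is the case of the smallest such move. *)
Definition grows (d1 d2 : bool) I z : bool :=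
  (lo z + d1 <= lo I)%N && (hi I + d2 <= hi z)%N.

Definition neighbour (d1 d2 : bool) I z : bool :=
  (lo z + d1 == lo I)%N && (hi I + d2 == hi z)%N.

(** The closed form of the Moebius function: the poset is locally a product of two
    chains, and the factor of a chain is [1] at the point, [-1] at its successor
    and [0] elsewhere. *)
Definition nu I z : int :=
  (neighbour false false I z)%:Z - (neighbour true false I z)%:Z
  - (neighbour false true I z)%:Z + (neighbour true true I z)%:Z.

Definition has_grown P (d1 d2 : bool) I : bool :=
  [exists z, P z && grows d1 d2 I z].

Lemma hitv_leE I J : (I <= J)%O = (lo J <= lo I)%N && (hi I <= hi J)%N.
Proof. exact: hleP. Qed.

(** There is at most one neighbour with given flags, and a down-set that contains
    an interval growing [I] contains that neighbour as well. *)
Lemma sum_neighbour P (d1 d2 : bool) I :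
  (forall z z', (z <= z')%O -> P z' -> P z) ->
  \sum_(z | P z) (neighbour d1 d2 I z)%:Z = (has_grown P d1 d2 I)%:Z.
Proof.
move=> down; rewrite /has_grown; case: existsP => [[z /andP[Pz /andP[lz hz]]]|none].
  have Ilt : (lo I < hi I)%N := ends_lt I.
  have lb : (lo I - d1 < n)%N by apply: leq_ltn_trans (leq_subr _ _) (ltn_ord _).
  have hb : (hi I + d2 < n)%N by apply: leq_ltn_trans hz (ltn_ord _).
  have lt : (lo I - d1 < hi I + d2)%N.
    by apply: leq_ltn_trans (leq_subr _ _) _; apply: leq_trans Ilt (leq_addr _ _).
  pose w := @HItv n (Ordinal lb, Ordinal hb) lt.
  have d1I : (d1 <= lo I)%N by apply: leq_trans lz; apply: leq_addl.
  have nw : neighbour d1 d2 I w by rewrite /neighbour /lo /hi /= subnK // !eqxx.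
  have Pw : P w.
    apply: down Pz; rewrite hitv_leE; apply/andP; split; rewrite /lo /hi //=.
    by rewrite leq_subRL // addnC.
  rewrite (bigD1 w) //= nw big1 ?addr0 // => v /andP[_ vw].
  case nv: (neighbour d1 d2 I v) => //; case/eqP: vw.
  move: nv nw => /andP[/eqP lv /eqP hv] /andP[/eqP lw /eqP hw].
  apply: val_inj; rewrite [LHS]surjective_pairing [RHS]surjective_pairing.
  congr pair; apply: val_inj.
    by apply: (@addIn d1); rewrite [LHS]lv [RHS]lw.
  by rewrite -[LHS]/(hi v : nat) -[RHS]/(hi w : nat) -hv hw.
rewrite big1 // => z Pz; case nz: neighbour => //; case: none; exists z.
by case/andP: nz => /eqP e1 /eqP e2; rewrite Pz /grows e1 e2 !leqnn.
Qed.

Lemma sum_nu P I : (forall z z', (z <= z')%O -> P z' -> P z) ->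
  \sum_(z | P z) nu I z =
  (has_grown P false false I)%:Z - (has_grown P true false I)%:Z
  - (has_grown P false true I)%:Z + (has_grown P true true I)%:Z.
Proof.
by move=> down; rewrite !big_split /= !sumrN !sum_neighbour.
Qed.

Lemma nu_out I z : ~~ (I <= z)%O -> nu I z = 0.
Proof.
rewrite hitv_leE => out; suff out' d1 d2 : neighbour d1 d2 I z = false.
  by rewrite /nu !out'.
apply/negP => /andP[/eqP e1 /eqP e2]; case/negP: out.
by rewrite -e1 -e2 !leq_addr.
Qed.

Lemma nu_refl I : nu I I = 1.
Proof.
by rewrite /nu /neighbour !addn0 !addn1 !eqxx !(gtn_eqF (ltnSn _)).
Qed.

(** With the down-set of all [z <= K], [sum_nu] shows that the sums of [nu] over
    intervals [[I, K]] vanish: at least one of the two ends of [K] differs from that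
    of [I], and the terms cancel in pairs. *)
Lemma moebius_hitv I J : (I <= J)%O -> moebius I J = nu I J.
Proof.
apply: moebius_unique => [|K IK]; first exact: nu_refl.
have -> : \sum_(z | (I <= z <= K)%O) nu I z = \sum_(z | (z <= K)%O) nu I z.
  rewrite [RHS](bigID (fun z => (I <= z)%O)) /= [X in _ = _ + X]big1 ?addr0.
    by apply: eq_bigl => z; rewrite andbC.
  by move=> z /andP[_]; exact: nu_out.
rewrite sum_nu; last by move=> z z'; exact: le_trans.
have grownE d1 d2 : has_grown (fun z => (z <= K)%O) d1 d2 I = grows d1 d2 I K.
  apply/existsP/idP => [[z]|gK]; last by exists K; rewrite lexx.
  rewrite hitv_leE /grows => /andP[/andP[l1 h1] /andP[l2 h2]].
  by rewrite (leq_trans _ l2) ?leq_add2r // (leq_trans h2).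
rewrite !grownE /grows !addn0 !addn1.
move: IK; rewrite lt_neqAle hitv_leE => /and3P[ne l h]; rewrite l h /=.
case: (ltnP (lo K) (lo I)) => l'; case: (ltnP (hi I) (hi K)) => h' //=.
case/eqP: ne; apply/le_anti; rewrite !hitv_leE l h /=; exact/andP.
Qed.

Lemma moebius_sum P I : (forall z z', (z <= z')%O -> P z' -> P z) ->
  \sum_(J | (I <= J)%O) moebius I J * (P J)%:Z =
  (P I)%:Z - (has_grown P true false I)%:Z
  - (has_grown P false true I)%:Z + (has_grown P true true I)%:Z.
Proof.
move=> down.
have -> : P I = has_grown P false false I.
  apply/idP/existsP => [PI|[z /andP[Pz]]].
    by exists I; rewrite PI /grows !addn0 !leqnn.
  by rewrite /grows !addn0 -hitv_leE => Iz; apply: down Pz.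
rewrite -sum_nu //; transitivity (\sum_(z | (I <= z)%O && P z) nu I z).
  rewrite [RHS]big_mkcondr; apply: eq_bigr => z Iz.
  by rewrite moebius_hitv //; case: (P z); rewrite ?mulr1 ?mulr0.
rewrite big_mkcondl; apply: eq_bigr => z _; case: ifPn => // out.
by rewrite nu_out.
Qed.

End IntervalMoebius.

(** * Landscape and graded persistence diagram *)

Section Landscape.
Context {F : fieldType} {R : realType} {m : nat} (M : pmod F 'I_m.+1).
Variables (iota : 'I_m.+2 -> R) (k : nat).
Hypothesis iota_inj : injective iota.
Hypothesis iota_homo : forall i j : 'I_m.+2, (i <= j)%N -> iota i <= iota j.
Hypothesis k_ge1 : (1 <= k)%N.

Definition persistent : pred (hitv m.+2) := fun J => (k <= Rank M J)%N.

Definition birth (J : hitv m.+2) : R := iota (lo J).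
Definition death (J : hitv m.+2) : R := iota (hi J).

Notation active := (active persistent birth death).
Notation peaks_at := (peaks_at persistent birth death).

Lemma persistent_down I J : (I <= J)%O -> persistent J -> persistent I.
Proof. by move=> IJ kJ; apply: leq_trans kJ (Rank_mono M IJ). Qed.

Lemma landscape_tents : landscape (bar M iota) k = tents persistent birth death.
Proof.
apply/funext => t; rewrite /landscape; set lam := tents _ _ _ t.
have -> : [set h | 0 < h /\ RankR_k (bar M iota) k (t - h) (t + h) = 1%N]%classic
    = `]0, lam]%classic.
  apply/seteqP; split=> h /=; rewrite ?in_itv /=.
    move=> [h0]; rewrite RankR_k_barP //; last by lra.
    by move=> ex; rewrite h0; apply/tents_geP.
  move=> /andP[h0 /tents_geP-/(_ h0) ex]; split=> //.
  by rewrite RankR_k_barP //; lra.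
have [l0|l0] := ltP 0 lam; first by rewrite sup_itv // bnd_simp.
have -> : lam = 0 by apply/le_anti; rewrite l0 tents_ge0.
by rewrite set_itv_ge ?sup0 // bnd_simp ltxx.
Qed.

Lemma PD_grown I : PD M k I =
  (persistent I)%:Z - (has_grown persistent true false I)%:Z
  - (has_grown persistent false true I)%:Z + (has_grown persistent true true I)%:Z.
Proof. exact: moebius_sum persistent_down. Qed.

Lemma grownP (d1 d2 : bool) I :
  reflect (exists z, [/\ persistent z, (lo z + d1 <= lo I)%N & (hi I + d2 <= hi z)%N])
    (has_grown persistent d1 d2 I).
Proof.
apply: (iffP existsP) => [[z /andP[pz /andP[l h]]]|[z [pz l h]]]; exists z => //.
by rewrite pz /grows l.
Qed.

Lemma has_grownW (d1 d2 d1' d2' : bool) I : (d1' <= d1)%N -> (d2' <= d2)%N ->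
  has_grown persistent d1 d2 I -> has_grown persistent d1' d2' I.
Proof.
move=> l1 l2 /grownP[z [pz l h]]; apply/grownP; exists z; split=> //.
  by apply: leq_trans l; rewrite leq_add2l.
by apply: leq_trans h; rewrite leq_add2l.
Qed.

Lemma persistent_grown I : has_grown persistent false false I = persistent I.
Proof.
apply/grownP/idP => [[z [pz l h]]|pI]; last by exists I; rewrite !addn0.
by apply: persistent_down pz; rewrite hitv_leE -[lo z : nat]addn0 l -[hi I : nat]addn0.
Qed.

Lemma PD_eq1 I : PD M k I = 1 <->
  [/\ persistent I, ~~ has_grown persistent true false I
    & ~~ has_grown persistent false true I].
Proof.
rewrite PD_grown -persistent_grown.
have := @has_grownW true true true false I isT isT.
have := @has_grownW true true false true I isT isT.
have := @has_grownW true false false false I isT isT.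
have := @has_grownW false true false false I isT isT.
by do 4!case: has_grown => //; move=> h1 h2 h3 h4;
  try (by have := h1 isT); try (by have := h2 isT); try (by have := h3 isT);
  try (by have := h4 isT); split=> [/eqP|[]].
Qed.

(** Strict growth on one side alone already makes [I] persistent, so the two
    negative terms together with the first give [1 - 1 - 1]. *)
Lemma PD_eqN1 I : PD M k I = -1 <->
  [/\ has_grown persistent true false I, has_grown persistent false true I
    & ~~ has_grown persistent true true I].
Proof.
rewrite PD_grown -persistent_grown.
have := @has_grownW true true true false I isT isT.
have := @has_grownW true true false true I isT isT.
have := @has_grownW true false false false I isT isT.
have := @has_grownW false true false false I isT isT.
by do 4!case: has_grown => //; move=> h1 h2 h3 h4;
  try (by have := h1 isT); try (by have := h2 isT); try (by have := h3 isT);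
  try (by have := h4 isT); split=> [/eqP|[]].
Qed.

Lemma PD_barE J : PD_bar M iota k (birth J) (death J) = PD M k J.
Proof.
rewrite /PD_bar; case: pickP => [I /andP[/eqP/iota_inj l /eqP/iota_inj h]|none].
  congr (PD M k _); apply: val_inj.
  by rewrite [LHS]surjective_pairing [RHS]surjective_pairing; congr pair.
by have := none J; rewrite !eqxx.
Qed.

Lemma PD_bar_neq0 a b : PD_bar M iota k a b != 0 ->
  exists2 J, birth J = a & death J = b.
Proof.
rewrite /PD_bar; case: pickP => [J /andP[/eqP aJ /eqP bJ] _|_]; last by rewrite eqxx.
by exists J.
Qed.

Let lam := tents persistent birth death.

(** An active interval with peak at [t] is [[t - h, t + h)] itself, so all active
    intervals peak at [t] exactly when this interval is maximal. *)
Lemma all_peak_PD t : 0 < lam t ->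
  (forall J, active t J -> peaks_at t J) <->
  PD_bar M iota k (t - lam t) (t + lam t) = 1.
Proof.
move=> t0; split=> [peak|PD1 z [pz bz dz]].
  have [J tJ] := active_ex t0; have [bJ dJ] := peak J tJ.
  rewrite /lam -bJ -dJ PD_barE PD_eq1; case: tJ => pJ _ _; split=> //;
    apply/grownP => -[z [pz]]; rewrite addn0 addn1 => l h.
  - have lz : birth z < birth J by rewrite iota_lt.
    have hz : death J <= death z by apply: iota_homo.
    have [|bz dz] := peak z; last by lra.
    by split=> //; [rewrite -bJ ltW|rewrite -dJ].
  - have lz : birth z <= birth J by apply: iota_homo.
    have hz : death J < death z by rewrite iota_lt.
    have [|bz dz] := peak z; last by lra.
    by split=> //; [rewrite -bJ|rewrite -dJ ltW].
have [|J bJ dJ] := @PD_bar_neq0 (t - lam t) (t + lam t); first by rewrite PD1.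
move: PD1; rewrite -bJ -dJ PD_barE PD_eq1 => -[pJ noleft noright].
move: bz dz; rewrite -/(lam t) -bJ -dJ !iota_le // => l h.
rewrite /peaks_at -/(lam t) -bJ -dJ; split; congr iota; apply/val_inj/eqP;
  rewrite eqn_leq ?l ?h ?andbT leqNgt; apply/negP => lt.
- by case/grownP: noleft; exists z; rewrite addn0 addn1.
- by case/grownP: noright; exists z; rewrite addn0 addn1.
Qed.

(** Two active intervals that reach beyond [t - h] and beyond [t + h] respectively
    share the ends of [[t - h, t + h)] on the other sides, because no persistent
    interval contains that one strictly on both sides; so it is a grid interval. *)
Lemma both_sides_PD t : 0 < lam t ->
  ((exists2 J, active t J & birth J < t - lam t) /\
   (exists2 J, active t J & t + lam t < death J)) <->
  PD_bar M iota k (t - lam t) (t + lam t) = -1.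
Proof.
move=> t0; split=> [[[y [py by_ dy] ly] [z [pz bz dz] hz]]|PDN1].
  have ey : death y = t + lam t.
    apply/eqP; rewrite eq_le dy andbT leNgt; apply/negP => lt.
    exact: (tents_not_inner py (conj ly lt)).
  have ez : birth z = t - lam t.
    apply/eqP; rewrite eq_le bz /= leNgt; apply/negP => lt.
    exact: (tents_not_inner pz (conj lt hz)).
  have lt : (lo z < hi y)%N by rewrite -(iota_lt iota_inj) // -/(birth z) -/(death y); lra.
  pose J := @HItv m.+2 (lo z, hi y) lt.
  have bJ : birth J = t - lam t by exact: ez.
  have dJ : death J = t + lam t by exact: ey.
  rewrite -bJ -dJ PD_barE PD_eqN1.
  split.
  - apply/grownP; exists y; rewrite addn0 addn1; split=> //.
    by rewrite -(iota_lt iota_inj) // -/(birth y) -/(birth J) bJ.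
  - apply/grownP; exists z; rewrite addn0 addn1; split=> //.
    by rewrite -(iota_lt iota_inj) // -/(death z) -/(death J) dJ.
  - apply/grownP => -[w [pw]]; rewrite !addn1 -!(iota_lt iota_inj) //.
    rewrite -/(birth w) -/(death w) -/(birth J) -/(death J) bJ dJ => lw hw.
    exact: (tents_not_inner pw (conj lw hw)).
have [|J bJ dJ] := @PD_bar_neq0 (t - lam t) (t + lam t); first by rewrite PDN1.
move: PDN1; rewrite -bJ -dJ PD_barE PD_eqN1 => -[/grownP left /grownP right _].
case: left right => y [py ly hy] [z [pz lz hz]].
move: ly hy lz hz; rewrite !addn0 !addn1 -!(iota_lt iota_inj) // -!(iota_le iota_inj) //.
rewrite -/(birth _) -/(death _) => ly hy lz hz; split; [exists y|exists z] => //.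
- by split=> //; rewrite -/(lam t) -?bJ -?dJ // ltW.
- by split=> //; rewrite -/(lam t) -?bJ -?dJ // ltW.
Qed.

End Landscape.

Theorem theorem5p2 (F : fieldType) (R : realType) (m : nat)
    (M : pmod F 'I_m.+1) (iota : 'I_m.+2 -> R)
    (iota_inj : injective iota)
    (iota_homo : forall i j : 'I_m.+2, (i <= j)%N -> iota i <= iota j)
    (k : nat) (k_ge1 : (1 <= k)%N) :
  let lambda := landscape (bar M iota) k in
  let PD_k := PD_bar M iota k in
  [/\ continuous lambda /\ piecewise_linear lambda,
      forall t : R, let h := lambda t in 0 < h ->
        (local_max lambda t <-> PD_k (t - h) (t + h) = 1) /\
        (local_min lambda t <-> PD_k (t - h) (t + h) = - 1)
    & forall t : R, derivable lambda t 1 ->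
        [\/ derive1 lambda t = - 1, derive1 lambda t = 0
          | derive1 lambda t = 1] /\
        (derive1 lambda t = 0 -> lambda t = 0)].
Proof.
rewrite /= landscape_tents //; split.
- by split; [exact: tents_continuous|exact: tents_piecewise_linear].
- move=> t t0; rewrite tents_local_maxP // tents_local_minP //.
  by split; [exact: all_peak_PD|exact: both_sides_PD].
move=> t dt; have := tents_ge0 (persistent M k) (birth iota) (death iota) t.
rewrite le_eqVlt => /predU1P[/esym t0|t0].
  by rewrite (tents_derive1_eq0 dt t0); split=> //; constructor 2.
case: (tents_derive1 dt t0) => ->; split; try by [constructor 1|constructor 3].
  by move/eqP; rewrite oppr_eq0 oner_eq0.
by move/eqP; rewrite oner_eq0.
Qed.
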